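(* Let $c\in\{-1,0,1\}$, let $\gamma:[0,\ell]\to M_c$ be a convex, closed curve, let $\gamma_\alpha$ be its $\alpha$-evolutoid and denote by $L(\gamma)$, $L(\gamma_\alpha)$ their respective lengths. If $\alpha\in[0,\alpha^* )$, then $$L(\gamma_\alpha)=\cos(\alpha)\cdot L(\gamma).$$
   Context: Space forms: for $c\in\{-1,0,1\}$ equip $\mathbb{R}^3$ with $\langle x,y\rangle_c=c\,x_1y_1+x_2y_2+x_3y_3$ and $\|x\|_c=\sqrt{\langle x,x\rangle_c}$. Let $M_{-1}=\{x:\langle x,x\rangle_{-1}=-1,\ x_1>0\}$, $M_0=\{x: x_1=0\}$, $M_1=\{x:\langle x,x\rangle_1=1\}$, each with the Riemannian metric induced by $\langle\cdot,\cdot\rangle_c$ (constant Gaussian curvature $c$). Trigonometry: $\sin_c(t)=\sinh t,\ t,\ \sin t$ and $\cos_c(t)=\cosh t,\ 1,\ \cos t$ for $c=-1,0,1$ respectively; $\tan_c=\sin_c/\cos_c$ and $\arctan_c$ is its inverse (principal value for $c=1$). For $p\in M_c$, a unit vector $v\in T_pM_c$ and $t\in\mathbb{R}$, $\exp^c_p(tv)=\cos_c(t)\,p+\sin_c(t)\,v$. Frenet frame: for an arc-length parametrized curve $\gamma$ in $M_c$, $\mathbf{t}=\gamma'$ and $\mathbf{e}=\gamma\wedge_c\mathbf{t}$ if $c=\pm1$, where $x\wedge_c y=(c(x_2y_3-x_3y_2),\,x_3y_1-x_1y_3,\,x_1y_2-x_2y_1)$, while $\mathbf{e}=\gamma''/\|\gamma''\|_0$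 if $c=0$. The geodesic curvature $k$ is defined by $\nabla_{\gamma'}\gamma'=k\,\mathbf{e}$. A smooth, closed, positively oriented, arc-length parametrized curve is called convex if $k(s)>0$ for all $s$ (when $c=0,1$) or $k(s)>1$ for all $s$ (when $c=-1$). Evolutoids: $\mathbf{v}_\alpha(s)=\cos(\alpha)\mathbf{t}(s)+\sin(\alpha)\mathbf{e}(s)$, $\rho_\alpha(s)=\arctan_c(\sin(\alpha)/k(s))$, and the $\alpha$-evolutoid of $\gamma$ is $\gamma_\alpha(s)=\exp^c_{\gamma(s)}(\rho_\alpha(s)\mathbf{v}_\alpha(s))$, $s\in[0,\ell]$. Definition of $\alpha^*$: $\alpha^*\in(0,\pi/2]$ is the maximal number such that $|\rho_\alpha'(s)|<\cos(\alpha)$ for all $\alpha\in[0,\alpha^* )$ and all $s\in[0,\ell]$. *)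

(* Defs.v *)
From Stdlib Require Import Reals Lra.
From Coquelicot Require Import Coquelicot.

Open Scope R_scope.

(** The three space forms are indexed by a three-element type that coerces to
    the curvature [c = -1, 0, 1]. *)
Inductive curvature : Set := Hyperbolic | Flat | Spherical.

Definition curv (c : curvature) : R :=
  match c with Hyperbolic => -1 | Flat => 0 | Spherical => 1 end.

Coercion curv : curvature >-> R.

Definition vec : Type := (R * R * R)%type.

Definition x1 (x : vec) : R := fst (fst x).
Definition x2 (x : vec) : R := snd (fst x).
Definition x3 (x : vec) : R := snd x.

Definition inner (c : curvature) (x y : vec) : R :=
  c * x1 x * x1 y + x2 x * x2 y + x3 x * x3 y.

Definition normc (c : curvature) (x : vec) : R := sqrt (inner c x x).

Definition wedge (c : curvature) (x y : vec) : vec :=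
  (c * (x2 x * x3 y - x3 x * x2 y),
   x3 x * x1 y - x1 x * x3 y,
   x1 x * x2 y - x2 x * x1 y).

Definition det3 (x y z : vec) : R :=
  x1 x * (x2 y * x3 z - x3 y * x2 z)
  - x2 x * (x1 y * x3 z - x3 y * x1 z)
  + x3 x * (x1 y * x2 z - x2 y * x1 z).

Definition in_M (c : curvature) (x : vec) : Prop :=
  match c with
  | Hyperbolic => inner c x x = -1 /\ 0 < x1 x
  | Flat => x1 x = 0
  | Spherical => inner c x x = 1
  end.

Definition sinc (c : curvature) (t : R) : R :=
  match c with Hyperbolic => sinh t | Flat => t | Spherical => sin t end.

Definition cosc (c : curvature) (t : R) : R :=
  match c with Hyperbolic => cosh t | Flat => 1 | Spherical => cos t end.

Definition tanc (c : curvature) (t : R) : R := sinc c t / cosc c t.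

(** For [c = -1] this is artanh, meaningful on (-1, 1); see [tanc_arctanc] and
    [arctanc_tanc]. *)
Definition arctanc (c : curvature) (x : R) : R :=
  match c with
  | Hyperbolic => / 2 * ln ((1 + x) / (1 - x))
  | Flat => x
  | Spherical => atan x
  end.

Lemma tanc_arctanc (c : curvature) (x : R) :
  (c = Hyperbolic -> -1 < x < 1) -> tanc c (arctanc c x) = x.
Proof.
destruct c; unfold tanc, arctanc, sinc, cosc; intros H.
- specialize (H eq_refl).
  set (y := / 2 * ln ((1 + x) / (1 - x))).
  assert (Hq : 0 < (1 + x) / (1 - x)) by (apply Rdiv_lt_0_compat; lra).
  assert (Hy : exp y * exp y = (1 + x) / (1 - x)).
  { rewrite <- exp_plus.
    replace (y + y) with (ln ((1 + x) / (1 - x))) by (unfold y; field).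
    now apply exp_ln. }
  assert (He := exp_pos y).
  unfold sinh, cosh; rewrite exp_Ropp.
  assert (Hm : exp y * exp y * (1 - x) = 1 + x) by (rewrite Hy; field; lra).
  apply Rmult_eq_reg_r with (exp y * exp y + 1); [|nra].
  transitivity (exp y * exp y - 1); [field; nra | lra].
- field.
- apply tan_atan.
Qed.

Lemma arctanc_tanc (c : curvature) (t : R) :
  (c = Spherical -> - PI / 2 < t < PI / 2) -> arctanc c (tanc c t) = t.
Proof.
destruct c; unfold tanc, arctanc, sinc, cosc; intros H.
- assert (He := exp_pos t).
  replace ((1 + sinh t / cosh t) / (1 - sinh t / cosh t)) with (exp (t + t)).
  + rewrite ln_exp; field.
  + rewrite exp_plus; unfold sinh, cosh; rewrite exp_Ropp; field.
    repeat split; nra.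
- field.
- specialize (H eq_refl). apply atan_tan; lra.
Qed.

(** [geo_exp c p v t] is exp_p(t v), for a unit tangent vector [v] at [p]. *)
Definition geo_exp (c : curvature) (p v : vec) (t : R) : vec :=
  plus (scal (cosc c t) p) (scal (sinc c t) v).

Definition vderive (g : R -> vec) (s : R) : vec :=
  (Derive (fun u => x1 (g u)) s,
   Derive (fun u => x2 (g u)) s,
   Derive (fun u => x3 (g u)) s).

Definition smooth (g : R -> vec) : Prop :=
  forall (n : nat) (s : R),
    ex_derive_n (fun u => x1 (g u)) n s /\
    ex_derive_n (fun u => x2 (g u)) n s /\
    ex_derive_n (fun u => x3 (g u)) n s.

Definition length (c : curvature) (g : R -> vec) (l : R) : R :=
  RInt (fun s => normc c (vderive g s)) 0 l.

Definition frame_t (g : R -> vec) : R -> vec := vderive g.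

Definition frame_e (c : curvature) (g : R -> vec) (s : R) : vec :=
  match c with
  | Flat => scal (/ normc Flat (vderive (vderive g) s)) (vderive (vderive g) s)
  | _ => wedge c (g s) (frame_t g s)
  end.

(** The covariant derivative of [g'] along [g] for the Levi-Civita connection
    of M_c: the component of [g''] tangent to M_c.  For [c = 1, -1] the normal
    space at [p] is spanned by [p], with <p, p>_c = c = 1 / c; for [c = 0]
    nothing is subtracted. *)
Definition cov_accel (c : curvature) (g : R -> vec) (s : R) : vec :=
  minus (vderive (vderive g) s)
        (scal (c * inner c (vderive (vderive g) s) (g s)) (g s)).

Definition geodesic_curvature
    (c : curvature) (g : R -> vec) (k : R -> R) : Prop :=
  forall s : R, cov_accel c g s = scal (k s) (frame_e c g s).

Definition normal (c : curvature) (p : vec) : vec :=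
  match c with Flat => (1, 0, 0) | _ => p end.

(** The Frenet frame is a positive basis of the tangent plane, oriented by
    [normal]; together with [k > 0] this says that the curve turns to the left.
    For [c = 1, -1] it holds by the choice of [e], so that the orientation is
    decided by the sign of [k].  For [c = 0], where [e] always points to the
    concave side, it says that the curve runs counterclockwise in the
    (x2, x3)-plane; it also entails [g'' <> 0], without which [e], and hence
    [k], would not be defined. *)
Definition positively_oriented (c : curvature) (g : R -> vec) : Prop :=
  forall s : R, 0 < det3 (normal c (g s)) (frame_t g s) (frame_e c g s).

(** A closed curve [0, l] -> M_c is represented by its [l]-periodic extension
    to the whole line, so that smoothness includes the closing point. *)
Record convex_closed_curve
    (c : curvature) (l : R) (g : R -> vec) (k : R -> R) : Prop := {
  cc_length_pos : 0 < l;
  cc_in_M : forall s : R, in_M c (g s);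
  cc_smooth : smooth g;
  cc_closed : forall s : R, g (s + l) = g s;
  cc_arc_length : forall s : R, normc c (vderive g s) = 1;
  cc_oriented : positively_oriented c g;
  cc_curvature : geodesic_curvature c g k;
  cc_convex : forall s : R,
    match c with Hyperbolic => 1 < k s | _ => 0 < k s end
}.

Definition v_alpha (c : curvature) (g : R -> vec) (alpha s : R) : vec :=
  plus (scal (cos alpha) (frame_t g s)) (scal (sin alpha) (frame_e c g s)).

Definition rho (c : curvature) (k : R -> R) (alpha s : R) : R :=
  arctanc c (sin alpha / k s).

Definition evolutoid
    (c : curvature) (g : R -> vec) (k : R -> R) (alpha s : R) : vec :=
  geo_exp c (g s) (v_alpha c g alpha s) (rho c k alpha s).

Definition alpha_admissible
    (c : curvature) (l : R) (k : R -> R) (a : R) : Prop :=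
  0 < a <= PI / 2 /\
  forall alpha s : R, 0 <= alpha < a -> 0 <= s <= l ->
    Rabs (Derive (rho c k alpha) s) < cos alpha.

Definition is_alpha_star
    (c : curvature) (l : R) (k : R -> R) (a : R) : Prop :=
  alpha_admissible c l k a /\
  forall b : R, alpha_admissible c l k b -> b <= a.

(* Main.v *)
Require Import Defs.
From Stdlib Require Import Reals Lra.
From Coquelicot Require Import Coquelicot.

Open Scope R_scope.

(** The Frenet equations in a space form of curvature [c] are
    [t' = k e - c g] and [e' = - k t].  Let [C] and [S] be the generalized
    cosine and sine of [rho], let [v = cos alpha t + sin alpha e], and let
    [n = cos alpha e - sin alpha t] be its quarter turn.  Differentiating
    [C g + S v] and decomposing along [g], [v] and [n] gives

      [(rho' + cos alpha) (C v - c S g) + (k S - sin alpha C) n].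

    The radius [rho] is chosen exactly so that [S / C = sin alpha / k], which
    kills the second term: the evolutoid is tangent to the geodesic that
    generates it ([evolutoid_velocity]).  As [C v - c S g] is the unit
    velocity of that geodesic, the speed of the evolutoid is
    [|rho' + cos alpha|] ([evolutoid_speed]).  Below [alpha_star] the bound
    [|rho'| < cos alpha] removes the absolute value, and the integral of
    [rho'] over a period vanishes because [k], hence [rho], is periodic.  What
    remains is the integral of the constant [cos alpha].

    The three geometries are treated at once.  The one obstacle is that in the
    plane [e] is defined by normalizing [g'']; orientation forces it to be the
    quarter turn of [t], so that in every case [e] is the wedge of the unit
    normal of the surface with [t] ([frame_e_normal]).  Facts on the inner
    products with [g] hold uniformly once multiplied by [c], since for [c = 0]
    the position vector does not enter. *)

(** * Vector algebra *)

Lemma vec_ext (x y : vec) :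
  x1 x = x1 y -> x2 x = x2 y -> x3 x = x3 y -> x = y.
Proof.
destruct x as [[a b] d]; destruct y as [[a' b'] d'].
unfold x1, x2, x3; simpl; congruence.
Qed.

Lemma x1_plus (x y : vec) : x1 (plus x y) = x1 x + x1 y.
Proof. reflexivity. Qed.

Lemma x2_plus (x y : vec) : x2 (plus x y) = x2 x + x2 y.
Proof. reflexivity. Qed.

Lemma x3_plus (x y : vec) : x3 (plus x y) = x3 x + x3 y.
Proof. reflexivity. Qed.

Lemma x1_scal (a : R) (x : vec) : x1 (scal a x) = a * x1 x.
Proof. reflexivity. Qed.

Lemma x2_scal (a : R) (x : vec) : x2 (scal a x) = a * x2 x.
Proof. reflexivity. Qed.

Lemma x3_scal (a : R) (x : vec) : x3 (scal a x) = a * x3 x.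
Proof. reflexivity. Qed.

Lemma x1_minus (x y : vec) : x1 (minus x y) = x1 x - x1 y.
Proof. reflexivity. Qed.

Lemma x2_minus (x y : vec) : x2 (minus x y) = x2 x - x2 y.
Proof. reflexivity. Qed.

Lemma x3_minus (x y : vec) : x3 (minus x y) = x3 x - x3 y.
Proof. reflexivity. Qed.

Ltac coords_once :=
  rewrite ?x1_minus, ?x2_minus, ?x3_minus, ?x1_plus, ?x2_plus, ?x3_plus,
    ?x1_scal, ?x2_scal, ?x3_scal.

(* Two passes reach the innermost terms of nested combinations. *)
Ltac coords := coords_once; coords_once.

Lemma inner_sym (c : curvature) (x y : vec) : inner c x y = inner c y x.
Proof. unfold inner; ring. Qed.

Lemma inner_plus_l (c : curvature) (x y z : vec) :
  inner c (plus x y) z = inner c x z + inner c y z.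
Proof. unfold inner; coords; ring. Qed.

Lemma inner_plus_r (c : curvature) (x y z : vec) :
  inner c z (plus x y) = inner c z x + inner c z y.
Proof. unfold inner; coords; ring. Qed.

Lemma inner_scal_l (c : curvature) (a : R) (x z : vec) :
  inner c (scal a x) z = a * inner c x z.
Proof. unfold inner; coords; ring. Qed.

Lemma inner_scal_r (c : curvature) (a : R) (x z : vec) :
  inner c z (scal a x) = a * inner c z x.
Proof. unfold inner; coords; ring. Qed.

(** The inner product is indefinite for [c = -1], where [sqrt] truncates
    negative values to [0]; a norm equal to [1] excludes that. *)
Lemma inner_of_normc (c : curvature) (x : vec) :
  normc c x = 1 -> inner c x x = 1.
Proof.
unfold normc; intros H.
destruct (Rle_or_lt 0 (inner c x x)) as [Hp | Hn].
- rewrite <- (sqrt_sqrt _ Hp), H; ring.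
- rewrite sqrt_neg_0 in H; lra.
Qed.

(** * Velocity of a curve in coordinates *)

(** [vderive] is total; this relation adds that the derivatives exist. *)
Definition has_velocity (f : R -> vec) (s : R) (u : vec) : Prop :=
  is_derive (fun r => x1 (f r)) s (x1 u) /\
  is_derive (fun r => x2 (f r)) s (x2 u) /\
  is_derive (fun r => x3 (f r)) s (x3 u).

Lemma has_velocity_vderive (f : R -> vec) (s : R) (u : vec) :
  has_velocity f s u -> vderive f s = u.
Proof.
intros (H1 & H2 & H3).
apply vec_ext; unfold vderive, x1 at 1, x2 at 1, x3 at 1; simpl;
  now apply is_derive_unique.
Qed.

Lemma has_velocity_ext (f h : R -> vec) (s : R) (u : vec) :
  (forall r, f r = h r) -> has_velocity f s u -> has_velocity h s u.
Proof.
intros E (H1 & H2 & H3).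
split; [|split].
- eapply is_derive_ext; [| exact H1]; intros r; exact (f_equal x1 (E r)).
- eapply is_derive_ext; [| exact H2]; intros r; exact (f_equal x2 (E r)).
- eapply is_derive_ext; [| exact H3]; intros r; exact (f_equal x3 (E r)).
Qed.

Lemma has_velocity_const (p : vec) (s : R) :
  has_velocity (fun _ => p) s (0, 0, 0).
Proof. split; [|split]; apply @is_derive_const. Qed.

Lemma has_velocity_plus (f h : R -> vec) (s : R) (u w : vec) :
  has_velocity f s u -> has_velocity h s w ->
  has_velocity (fun r => plus (f r) (h r)) s (plus u w).
Proof.
intros (F1 & F2 & F3) (H1 & H2 & H3).
split; [|split]; now apply @is_derive_plus.
Qed.

Lemma is_derive_mult_R (f h : R -> R) (s a b : R) :
  is_derive f s a -> is_derive h s b ->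
  is_derive (fun r => f r * h r) s (a * h s + f s * b).
Proof. intros F H; apply (is_derive_mult f h s a b F H); exact Rmult_comm. Qed.

Lemma has_velocity_scal (a : R -> R) (f : R -> vec) (s da : R) (u : vec) :
  is_derive a s da -> has_velocity f s u ->
  has_velocity (fun r => scal (a r) (f r)) s
    (plus (scal da (f s)) (scal (a s) u)).
Proof.
intros A (F1 & F2 & F3).
split; [|split]; now apply is_derive_mult_R.
Qed.

Lemma is_derive_inner (c : curvature) (f h : R -> vec) (s : R) (u w : vec) :
  has_velocity f s u -> has_velocity h s w ->
  is_derive (fun r => inner c (f r) (h r)) s
    (inner c u (h s) + inner c (f s) w).
Proof.
intros (F1 & F2 & F3) (H1 & H2 & H3); unfold inner.
replace (_ + _) with
  (plus (plus (c * x1 u * x1 (h s) + c * x1 (f s) * x1 w)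
              (x2 u * x2 (h s) + x2 (f s) * x2 w))
        (x3 u * x3 (h s) + x3 (f s) * x3 w))
  by (unfold plus; simpl; ring).
exact (is_derive_plus _ _ _ _ _
  (is_derive_plus _ _ _ _ _
    (is_derive_mult_R _ _ _ _ _ (is_derive_scal _ _ c _ F1) H1)
    (is_derive_mult_R _ _ _ _ _ F2 H2))
  (is_derive_mult_R _ _ _ _ _ F3 H3)).
Qed.

Lemma is_derive_cross (a b p q : R -> R) (s da db dp dq : R) :
  is_derive a s da -> is_derive b s db ->
  is_derive p s dp -> is_derive q s dq ->
  is_derive (fun r => a r * b r - p r * q r) s
    (da * b s - dp * q s + (a s * db - p s * dq)).
Proof.
intros A B P Q.
replace (da * b s - dp * q s + (a s * db - p s * dq)) with
  (minus (da * b s + a s * db) (dp * q s + p s * dq))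
  by (unfold minus, plus, opp; simpl; ring).
apply (is_derive_minus (fun r => a r * b r) (fun r => p r * q r));
  now apply is_derive_mult_R.
Qed.

Lemma has_velocity_wedge (c : curvature) (f h : R -> vec) (s : R) (u w : vec) :
  has_velocity f s u -> has_velocity h s w ->
  has_velocity (fun r => wedge c (f r) (h r)) s
    (plus (wedge c u (h s)) (wedge c (f s) w)).
Proof.
intros (F1 & F2 & F3) (H1 & H2 & H3).
split; [|split].
- change (is_derive
    (fun r => c * (x2 (f r) * x3 (h r) - x3 (f r) * x2 (h r))) s
    (c * (x2 u * x3 (h s) - x3 u * x2 (h s))
     + c * (x2 (f s) * x3 w - x3 (f s) * x2 w))).
  rewrite <- Rmult_plus_distr_l.
  apply is_derive_scal; now apply is_derive_cross.
- now apply (is_derive_cross (fun r => x3 (f r)) (fun r => x1 (h r))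
    (fun r => x1 (f r)) (fun r => x3 (h r))).
- now apply (is_derive_cross (fun r => x1 (f r)) (fun r => x2 (h r))
    (fun r => x2 (f r)) (fun r => x1 (h r))).
Qed.

Lemma vderive_shift (f : R -> vec) (l : R) :
  (forall s, f (s + l) = f s) -> forall s, vderive f (s + l) = vderive f s.
Proof.
intros P s.
assert (D : forall p : vec -> R,
  Derive (fun u => p (f u)) (s + l) = Derive (fun u => p (f u)) s).
{ intros p.
  change (Derive_n (fun u => p (f u)) 1 (s + l) = Derive (fun u => p (f u)) s).
  rewrite <- (Derive_n_comp_trans (fun u => p (f u)) 1 s l).
  apply Derive_ext; intros r; now rewrite P. }
unfold vderive; now rewrite (D x1), (D x2), (D x3).
Qed.

(** * Generalized trigonometry *)

Lemma is_derive_cosc (c : curvature) (t : R) :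
  is_derive (cosc c) t (- c * sinc c t).
Proof.
destruct c; unfold cosc, sinc, curv.
- apply is_derive_Reals. replace (- -1 * sinh t) with (sinh t) by ring.
  apply derivable_pt_lim_cosh.
- replace (- 0 * t) with 0 by ring; apply @is_derive_const.
- apply is_derive_Reals. replace (- (1) * sin t) with (- sin t) by ring.
  apply derivable_pt_lim_cos.
Qed.

Lemma is_derive_sinc (c : curvature) (t : R) :
  is_derive (sinc c) t (cosc c t).
Proof.
destruct c; unfold cosc, sinc.
- apply is_derive_Reals, derivable_pt_lim_sinh.
- apply @is_derive_id.
- apply is_derive_Reals, derivable_pt_lim_sin.
Qed.

Lemma cosc2_sinc2 (c : curvature) (t : R) :
  cosc c t * cosc c t + c * (sinc c t * sinc c t) = 1.
Proof.
destruct c; unfold cosc, sinc, curv.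
- unfold cosh, sinh; rewrite exp_Ropp.
  assert (H := exp_pos t); field; lra.
- ring.
- generalize (sin2_cos2 t); unfold Rsqr; lra.
Qed.

Lemma is_derive_arctanc (c : curvature) (x : R) :
  (c = Hyperbolic -> -1 < x < 1) ->
  is_derive (arctanc c) x (/ (1 + c * x ^ 2)).
Proof.
intros B; destruct c; unfold arctanc, curv.
- specialize (B eq_refl).
  assert (0 < (1 + x) / (1 - x)) by (apply Rdiv_lt_0_compat; lra).
  auto_derive.
  + split; [lra | split; [exact H | easy]].
  + field; repeat split; nra.
- replace (/ (1 + 0 * x ^ 2)) with 1 by (field; lra).
  apply @is_derive_id.
- apply is_derive_Reals.
  replace (/ (1 + 1 * x ^ 2)) with (/ (1 + x ^ 2)) by (f_equal; ring).
  apply derivable_pt_lim_atan.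
Qed.

Lemma sinc_arctanc (c : curvature) (x : R) :
  (c = Hyperbolic -> -1 < x < 1) ->
  sinc c (arctanc c x) = x * cosc c (arctanc c x).
Proof.
intros B.
rewrite <- (tanc_arctanc c x B) at 2; unfold tanc; field.
destruct c; unfold cosc.
- unfold cosh; assert (H := exp_pos (arctanc Hyperbolic x)).
  assert (H' := exp_pos (- arctanc Hyperbolic x)); lra.
- lra.
- unfold arctanc; destruct (atan_bound x) as [L U].
  apply Rgt_not_eq, cos_gt_0; lra.
Qed.

(** * Frenet equations *)

Lemma wedge_orthogonal_r (c : curvature) (x y : vec) :
  c <> Flat -> inner c (wedge c x y) y = 0.
Proof.
intros N; destruct c; [| now destruct N |];
  unfold inner, wedge, curv, x1, x2, x3; simpl; ring.
Qed.

Lemma wedge_orthogonal_l (c : curvature) (x y : vec) :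
  c <> Flat -> inner c x (wedge c x y) = 0.
Proof.
intros N; destruct c; [| now destruct N |];
  unfold inner, wedge, curv, x1, x2, x3; simpl; ring.
Qed.

Lemma inner_wedge_wedge (c : curvature) (x y : vec) :
  c <> Flat ->
  inner c (wedge c x y) (wedge c x y)
  = c * (inner c x x * inner c y y - inner c x y * inner c x y).
Proof.
intros N; destruct c; [| now destruct N |];
  unfold inner, wedge, curv, x1, x2, x3; simpl; ring.
Qed.

Lemma wedge_wedge (c : curvature) (x y : vec) :
  c <> Flat ->
  wedge c x (wedge c x y)
  = scal (curv c) (plus (scal (inner c x y) x) (scal (- inner c x x) y)).
Proof.
intros N; destruct c; [| now destruct N |];
  apply vec_ext; coords; unfold inner, wedge, curv, x1, x2, x3; simpl; ring.
Qed.

Lemma wedge_linear_r (c : curvature) (a b : R) (x y z : vec) :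
  wedge c x (plus (scal a y) (scal b z))
  = plus (scal a (wedge c x y)) (scal b (wedge c x z)).
Proof.
apply vec_ext; coords; destruct x as [[? ?] ?], y as [[? ?] ?], z as [[? ?] ?];
  unfold wedge, x1, x2, x3; simpl;
  unfold scal, plus; simpl; unfold mult; simpl; ring.
Qed.

Lemma wedge_diag (c : curvature) (x : vec) : wedge c x x = (0, 0, 0).
Proof. apply vec_ext; unfold wedge, x1, x2, x3; simpl; ring. Qed.

Lemma curv_square (c : curvature) : c <> Flat -> c * c = 1.
Proof. intros N; destruct c; unfold curv; [ring | now destruct N | ring]. Qed.

Lemma flat_dec (c : curvature) : {c = Flat} + {c <> Flat}.
Proof. destruct c; [right | left | right]; congruence. Qed.

(** Both sides are unit vectors of the plane orthogonal to [t]; the orientation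
    decides between the two. *)
Lemma plane_normal_unique (t a : vec) :
  x1 t = 0 -> x1 a = 0 -> inner Flat t t = 1 -> inner Flat a t = 0 ->
  0 < det3 (1, 0, 0) t (scal (/ normc Flat a) a) ->
  scal (/ normc Flat a) a = wedge Flat (1, 0, 0) t.
Proof.
intros T1 A1 TT AT O.
assert (SS : 0 <= inner Flat a a) by (unfold inner, curv; nra).
assert (N2 := sqrt_sqrt _ SS); fold (normc Flat a) in N2.
assert (N0 := sqrt_pos (inner Flat a a)); fold (normc Flat a) in N0.
assert (NZ : normc Flat a <> 0).
{ intros Z; rewrite Z in N2; unfold inner, curv in N2.
  assert (A2 : x2 a = 0) by nra; assert (A3 : x3 a = 0) by nra.
  revert O; unfold det3; coords; rewrite A1, A2, A3; lra. }
set (e := scal (/ normc Flat a) a) in *.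
assert (E1 : x1 e = 0) by (unfold e; coords; rewrite A1; ring).
assert (EE : inner Flat e e = 1)
  by (unfold e; rewrite inner_scal_l, inner_scal_r, <- N2; field; exact NZ).
assert (ET : inner Flat e t = 0)
  by (unfold e; rewrite inner_scal_l, AT; ring).
unfold inner, curv in TT, EE, ET.
assert (D : x2 t * x3 e - x3 t * x2 e = 1).
{ unfold det3 in O; change (x1 (1, 0, 0)) with 1 in O.
  change (x2 (1, 0, 0)) with 0 in O; change (x3 (1, 0, 0)) with 0 in O.
  assert ((x2 t * x3 e - x3 t * x2 e) ^ 2 = 1).
  { transitivity ((x2 t * x2 t + x3 t * x3 t) * (x2 e * x2 e + x3 e * x3 e)
                  - (x2 e * x2 t + x3 e * x3 t) ^ 2); [ring|].
    replace (x2 t * x2 t + x3 t * x3 t) with 1 by lra.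
    replace (x2 e * x2 e + x3 e * x3 e) with 1 by lra.
    replace (x2 e * x2 t + x3 e * x3 t) with 0 by lra. ring. }
  nra. }
assert (TT' : x2 t * x2 t + x3 t * x3 t = 1) by lra.
assert (ET' : x2 e * x2 t + x3 e * x3 t = 0) by lra.
apply vec_ext.
- rewrite E1; unfold wedge, x1, curv; simpl; ring.
- transitivity (- x3 t); [| unfold wedge, x1, x2, x3; simpl; ring].
  replace (x2 e) with (x2 t * (x2 e * x2 t + x3 e * x3 t)
    - x3 t * (x2 t * x3 e - x3 t * x2 e)
    + x2 e * (1 - (x2 t * x2 t + x3 t * x3 t))) by ring.
  rewrite TT', ET', D; ring.
- transitivity (x2 t); [| unfold wedge, x1, x2, x3; simpl; ring].
  replace (x3 e) with (x3 t * (x2 e * x2 t + x3 e * x3 t)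
    + x2 t * (x2 t * x3 e - x3 t * x2 e)
    + x3 e * (1 - (x2 t * x2 t + x3 t * x3 t))) by ring.
  rewrite TT', ET', D; ring.
Qed.


Section Frenet.

Variables (c : curvature) (l : R) (g : R -> vec) (k : R -> R).
Hypothesis Hg : convex_closed_curve c l g k.

Lemma velocity_g (s : R) : has_velocity g s (vderive g s).
Proof.
destruct (cc_smooth _ _ _ _ Hg 1%nat s) as (H1 & H2 & H3).
split; [|split]; now apply Derive_correct.
Qed.

Lemma velocity_t (s : R) :
  has_velocity (vderive g) s (vderive (vderive g) s).
Proof.
destruct (cc_smooth _ _ _ _ Hg 2%nat s) as (H1 & H2 & H3).
split; [|split]; now apply Derive_correct.
Qed.

Lemma velocity_accel (s : R) :
  has_velocity (vderive (vderive g)) s (vderive (vderive (vderive g)) s).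
Proof.
destruct (cc_smooth _ _ _ _ Hg 3%nat s) as (H1 & H2 & H3).
split; [|split]; now apply Derive_correct.
Qed.

Lemma velocity_jerk (s : R) :
  has_velocity (vderive (vderive (vderive g))) s
    (vderive (vderive (vderive (vderive g))) s).
Proof.
destruct (cc_smooth _ _ _ _ Hg 4%nat s) as (H1 & H2 & H3).
split; [|split]; now apply Derive_correct.
Qed.

Lemma inner_tt (s : R) : inner c (vderive g s) (vderive g s) = 1.
Proof. apply inner_of_normc, (cc_arc_length _ _ _ _ Hg). Qed.

Lemma inner_accel_t (s : R) :
  inner c (vderive (vderive g) s) (vderive g s) = 0.
Proof.
assert (H := is_derive_inner c _ _ s _ _ (velocity_t s) (velocity_t s)).
apply is_derive_unique in H.
rewrite (Derive_ext _ (fun _ => 1)), Derive_const in H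
  by (intros; apply inner_tt).
rewrite (inner_sym c (vderive g s)) in H; lra.
Qed.

Lemma inner_gg (s : R) : c <> Flat -> inner c (g s) (g s) = c.
Proof.
intros N; generalize (cc_in_M _ _ _ _ Hg s).
destruct c; unfold in_M; [tauto | now destruct N | tauto].
Qed.

Lemma inner_g_t (s : R) : c <> Flat -> inner c (g s) (vderive g s) = 0.
Proof.
intros N.
assert (H := is_derive_inner c _ _ s _ _ (velocity_g s) (velocity_g s)).
apply is_derive_unique in H.
rewrite (Derive_ext _ (fun _ => curv c)), Derive_const in H
  by (intros; now apply inner_gg).
rewrite (inner_sym c (vderive g s)) in H; lra.
Qed.

Lemma inner_accel_g (s : R) :
  c <> Flat -> inner c (vderive (vderive g) s) (g s) = -1.
Proof.
intros N.
assert (H := is_derive_inner c _ _ s _ _ (velocity_g s) (velocity_t s)).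
apply is_derive_unique in H.
rewrite (Derive_ext _ (fun _ => 0)), Derive_const in H
  by (intros; now apply inner_g_t).
rewrite inner_tt, inner_sym in H; lra.
Qed.

Lemma flat_x1_t (s : R) : c = Flat -> x1 (vderive g s) = 0.
Proof.
intros E; unfold vderive, x1 at 1; simpl.
rewrite (Derive_ext _ (fun _ => 0)); [apply Derive_const|].
intros r; generalize (cc_in_M _ _ _ _ Hg r); now rewrite E.
Qed.

Lemma flat_x1_accel (s : R) : c = Flat -> x1 (vderive (vderive g) s) = 0.
Proof.
intros E; unfold vderive at 1, x1 at 1; simpl.
rewrite (Derive_ext _ (fun _ => 0)); [apply Derive_const|].
intros r; now apply flat_x1_t.
Qed.

(** Only for [c = 0] is this more than the definition of [e]; it lets the three
    geometries share one differentiable formula for [e]. *)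
Lemma frame_e_normal (s : R) :
  frame_e c g s = wedge c (normal c (g s)) (vderive g s).
Proof.
assert (T := flat_x1_t s); assert (A := flat_x1_accel s).
assert (TT := inner_tt s); assert (AT := inner_accel_t s).
assert (O := cc_oriented _ _ _ _ Hg s).
clear Hg; destruct c; [reflexivity | | reflexivity].
now apply plane_normal_unique; auto.
Qed.

Lemma frame_e_flat (s : R) :
  c = Flat -> frame_e c g s = (0, - x3 (vderive g s), x2 (vderive g s)).
Proof.
intros E; rewrite frame_e_normal, E.
apply vec_ext; unfold wedge, normal, curv, x1, x2, x3; simpl; ring.
Qed.

Lemma inner_e_t (s : R) : inner c (frame_e c g s) (vderive g s) = 0.
Proof.
destruct (flat_dec c) as [E | N].
- rewrite (frame_e_flat s E), E.
  unfold inner, x1, x2, x3, curv; simpl; ring.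
- rewrite frame_e_normal; now apply wedge_orthogonal_r.
Qed.

Lemma normal_nonflat (p : vec) : c <> Flat -> normal c p = p.
Proof. intros N; destruct c; [easy | now destruct N | easy]. Qed.

Lemma inner_e_e (s : R) : inner c (frame_e c g s) (frame_e c g s) = 1.
Proof.
destruct (flat_dec c) as [E | N].
- generalize (inner_tt s); rewrite (frame_e_flat s E), E.
  unfold inner, x1, x2, x3, curv; simpl; lra.
- rewrite frame_e_normal, (normal_nonflat _ N), (inner_wedge_wedge _ _ _ N),
    inner_tt, (inner_gg s N), (inner_g_t s N).
  generalize (curv_square c N); lra.
Qed.

Lemma curv_inner_g_g (s : R) : c * (c * inner c (g s) (g s)) = c.
Proof.
destruct (flat_dec c) as [E | N].
- rewrite E; unfold curv; ring.
- rewrite (inner_gg s N), (curv_square c N); ring.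
Qed.

Lemma curv_inner_t_g (s : R) : c * inner c (vderive g s) (g s) = 0.
Proof.
destruct (flat_dec c) as [E | N].
- rewrite E; unfold curv; ring.
- rewrite inner_sym, (inner_g_t s N); ring.
Qed.

Lemma curv_inner_e_g (s : R) : c * inner c (frame_e c g s) (g s) = 0.
Proof.
destruct (flat_dec c) as [E | N].
- rewrite E; unfold curv; ring.
- rewrite frame_e_normal, (normal_nonflat _ N), inner_sym,
    (wedge_orthogonal_l _ _ _ N); ring.
Qed.

(** The covariant derivative drops the component of [g''] along [g]; twice
    differentiating [<g, g> = c] shows that this component is [- c g]. *)
Lemma frenet_t (s : R) :
  vderive (vderive g) s
  = plus (scal (k s) (frame_e c g s)) (scal (- c) (g s)).
Proof.
rewrite <- (cc_curvature _ _ _ _ Hg s); unfold cov_accel.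
replace (c * inner c (vderive (vderive g) s) (g s)) with (- c).
- apply vec_ext; coords; ring.
- destruct (flat_dec c) as [E | N].
  + rewrite E; unfold curv; ring.
  + rewrite (inner_accel_g s N); ring.
Qed.

(** Apply the product rule to [e = N /\ t], with [N] the unit normal.  For
    [c = 0] the normal is constant.  Otherwise [N = g]: the term [t /\ t]
    vanishes, and in [g /\ (k e - c g)] only [k g /\ e = - k t] survives. *)
Lemma frenet_e (s : R) :
  has_velocity (frame_e c g) s (scal (- k s) (vderive g s)).
Proof.
apply (has_velocity_ext (fun r => wedge c (normal c (g r)) (vderive g r)));
  [intros r; symmetry; apply frame_e_normal |].
destruct (flat_dec c) as [E | N].
- assert (V : has_velocity (fun r => normal c (g r)) s (0, 0, 0))
    by (rewrite E; exact (has_velocity_const (1, 0, 0) s)).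
  assert (W := has_velocity_wedge c _ _ s _ _ V (velocity_t s)).
  rewrite frenet_t, (frame_e_flat s E) in W.
  assert (T1 := flat_x1_t s E).
  replace (scal (- k s) (vderive g s)) with
    (plus (wedge c (0, 0, 0) (vderive g s))
      (wedge c (normal c (g s))
        (plus (scal (k s) (0, - x3 (vderive g s), x2 (vderive g s)))
          (scal (- c) (g s))))); [exact W |].
  rewrite E; revert T1; generalize (vderive g s) (g s).
  intros [[t1 t2] t3] [[p1 p2] p3]; unfold x1 at 1; simpl; intros ->.
  apply vec_ext; coords; unfold wedge, normal, curv, x1, x2, x3; simpl;
    unfold scal, plus; simpl; unfold mult; simpl; ring.
- apply (has_velocity_ext (fun r => wedge c (g r) (vderive g r)));
    [intros r; now rewrite normal_nonflat |].
  assert (W := has_velocity_wedge c _ _ s _ _ (velocity_g s) (velocity_t s)).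
  assert (F : wedge c (g s) (frame_e c g s) = scal (- 1) (vderive g s)).
  { rewrite frame_e_normal, (normal_nonflat _ N), (wedge_wedge _ _ _ N),
      (inner_g_t s N), (inner_gg s N).
    replace (- 1) with (- (c * c)) by (rewrite (curv_square c N); ring).
    apply vec_ext; coords; ring. }
  rewrite frenet_t, wedge_linear_r, F, !wedge_diag in W.
  replace (scal (- k s) (vderive g s)) with
    (plus ((0, 0, 0) : vec)
      (plus (scal (k s) (scal (- 1) (vderive g s)))
            (scal (- c) ((0, 0, 0) : vec)))); [exact W |].
  apply vec_ext; coords; unfold x1, x2, x3; simpl; ring.
Qed.

(** * Regularity and periodicity of the curvature *)

(** The curvature [k] is given only through the Frenet equation; this formula
    is the source of its regularity and periodicity. *)
Lemma curvature_inner (s : R) :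
  k s = inner c (vderive (vderive g) s) (frame_e c g s).
Proof.
rewrite frenet_t, inner_plus_l, !inner_scal_l, inner_e_e, (inner_sym c (g s)).
generalize (curv_inner_e_g s); lra.
Qed.

(** The derivative of [k]: the term with [e'] drops because [e'] is a multiple
    of [t], to which [g''] is orthogonal. *)
Definition dk (s : R) : R :=
  inner c (vderive (vderive (vderive g)) s) (frame_e c g s).

Lemma is_derive_curvature (s : R) : is_derive k s (dk s).
Proof.
apply (is_derive_ext
  (fun r => inner c (vderive (vderive g) r) (frame_e c g r)));
  [intros r; symmetry; apply curvature_inner |].
replace (dk s) with
  (inner c (vderive (vderive (vderive g)) s) (frame_e c g s)
   + inner c (vderive (vderive g) s) (scal (- k s) (vderive g s))).
- apply is_derive_inner; [apply velocity_accel | apply frenet_e].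
- rewrite inner_scal_r, inner_accel_t; unfold dk; ring.
Qed.

Lemma ex_derive_dk (s : R) : ex_derive dk s.
Proof.
eexists; apply is_derive_inner; [apply velocity_jerk | apply frenet_e].
Qed.

Lemma curvature_periodic (s : R) : k (s + l) = k s.
Proof.
assert (P := cc_closed _ _ _ _ Hg).
assert (P1 := vderive_shift g l P).
assert (P2 := vderive_shift _ l P1).
rewrite !curvature_inner, !frame_e_normal.
now rewrite P2, P1, P.
Qed.

Lemma curvature_pos (s : R) : 0 < k s.
Proof. generalize (cc_convex _ _ _ _ Hg s); destruct c; lra. Qed.

(** * Evolutoids *)

Variable alpha : R.

(** Hyperbolic convexity, [k > 1 >= |sin alpha|], keeps the argument within the
    domain of artanh. *)
Lemma rho_arg_bound (s : R) : c = Hyperbolic -> -1 < sin alpha / k s < 1.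
Proof.
intros E; generalize (cc_convex _ _ _ _ Hg s); rewrite E; intros K.
destruct (SIN_bound alpha) as [L U].
split.
- apply Rmult_lt_reg_r with (k s); [lra |].
  replace (sin alpha / k s * k s) with (sin alpha) by (field; lra); lra.
- apply Rmult_lt_reg_r with (k s); [lra |].
  replace (sin alpha / k s * k s) with (sin alpha) by (field; lra); lra.
Qed.

Lemma rho_denominator_pos (s : R) : 0 < k s ^ 2 + c * sin alpha ^ 2.
Proof.
generalize (cc_convex _ _ _ _ Hg s) (SIN_bound alpha).
destruct c; unfold curv; nra.
Qed.

Definition drho (s : R) : R :=
  - sin alpha * dk s / (k s ^ 2 + c * sin alpha ^ 2).

Lemma is_derive_rho (s : R) : is_derive (rho c k alpha) s (drho s).
Proof.
assert (Q : is_derive (fun r => sin alpha / k r) s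
              (- sin alpha * dk s / k s ^ 2)).
{ assert (P := curvature_pos s).
  replace (- sin alpha * dk s / k s ^ 2) with (sin alpha * (- dk s / k s ^ 2))
    by (field; lra).
  apply (is_derive_scal (fun r => / k r)), is_derive_inv;
    [apply is_derive_curvature | lra]. }
assert (A := is_derive_arctanc c _ (rho_arg_bound s)).
assert (H := is_derive_comp (arctanc c) (fun r => sin alpha / k r) _ _ _ A Q).
replace (drho s) with
  (scal (- sin alpha * dk s / k s ^ 2) (/ (1 + c * (sin alpha / k s) ^ 2)));
  [exact H |].
unfold drho, scal; simpl; unfold mult; simpl.
assert (P := curvature_pos s); assert (D := rho_denominator_pos s).
field; repeat split; lra.
Qed.

Lemma continuous_drho (s : R) : continuous drho s.
Proof.
apply (ex_derive_continuous drho); unfold drho.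
assert (D := rho_denominator_pos s).
auto_derive.
split; [apply ex_derive_dk |].
split; [eexists; apply is_derive_curvature |].
split; [simpl in D; lra | easy].
Qed.

Lemma rho_periodic (s : R) : rho c k alpha (s + l) = rho c k alpha s.
Proof. unfold rho; now rewrite curvature_periodic. Qed.

(** The defining property of [rho], freed of denominators: it cancels the
    component of the velocity of the evolutoid along [n]. *)
Lemma k_sinc_rho (s : R) :
  k s * sinc c (rho c k alpha s) = sin alpha * cosc c (rho c k alpha s).
Proof.
unfold rho; rewrite (sinc_arctanc c _ (rho_arg_bound s)).
assert (P := curvature_pos s); field; lra.
Qed.

(** The velocity at time [rho] of the geodesic that leaves [g s] with velocity
    [v]. *)
Definition geodesic_direction (s : R) : vec :=
  plus (scal (cosc c (rho c k alpha s)) (v_alpha c g alpha s))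
       (scal (- c * sinc c (rho c k alpha s)) (g s)).

Lemma evolutoid_velocity (s : R) :
  has_velocity (evolutoid c g k alpha) s
    (scal (drho s + cos alpha) (geodesic_direction s)).
Proof.
set (C := cosc c (rho c k alpha s)); set (S := sinc c (rho c k alpha s)).
assert (Hv : has_velocity (v_alpha c g alpha) s
  (plus (plus (scal 0 (vderive g s))
              (scal (cos alpha) (vderive (vderive g) s)))
        (plus (scal 0 (frame_e c g s))
              (scal (sin alpha) (scal (- k s) (vderive g s)))))).
{ apply has_velocity_plus.
  - apply (has_velocity_scal (fun _ => cos alpha));
      [apply @is_derive_const | apply velocity_t].
  - apply (has_velocity_scal (fun _ => sin alpha));
      [apply @is_derive_const | apply frenet_e]. }
assert (HC : is_derive (fun r => cosc c (rho c k alpha r)) s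
               (drho s * (- c * S)))
  by (apply (is_derive_comp (cosc c) (rho c k alpha));
      [apply is_derive_cosc | apply is_derive_rho]).
assert (HS : is_derive (fun r => sinc c (rho c k alpha r)) s (drho s * C))
  by (apply (is_derive_comp (sinc c) (rho c k alpha));
      [apply is_derive_sinc | apply is_derive_rho]).
assert (H := has_velocity_plus _ _ s _ _
  (has_velocity_scal _ _ s _ _ HC (velocity_g s))
  (has_velocity_scal _ _ s _ _ HS Hv)).
rewrite frenet_t in H; fold C S in H.
eapply (eq_ind _ (has_velocity (evolutoid c g k alpha) s) H).
unfold geodesic_direction, v_alpha, frame_t; fold C S.
assert (KS : k s * S = sin alpha * C) by apply k_sinc_rho.
assert (Q : sin alpha * sin alpha + cos alpha * cos alpha = 1)
  by apply (sin2_cos2 alpha).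
(* The difference of the two sides is the normal component, a multiple of
   [k S - sin alpha C], up to the Pythagorean identity in [alpha]. *)
assert (Z : forall t e p : R,
  drho s * (- c * S) * p + C * t
  + (drho s * C * (cos alpha * t + sin alpha * e)
     + S * (0 * t + cos alpha * (k s * e + - c * p)
            + (0 * e + sin alpha * (- k s * t))))
  = (drho s + cos alpha)
    * (C * (cos alpha * t + sin alpha * e) + - c * S * p)).
{ intros t e p; apply Rminus_diag_uniq.
  transitivity ((k s * S - sin alpha * C) * (cos alpha * e - sin alpha * t)
    + C * t * (1 - (sin alpha * sin alpha + cos alpha * cos alpha)));
    [ring | rewrite KS, Q; ring]. }
apply vec_ext; coords; apply Z.
Qed.

Lemma inner_v_v (s : R) :
  inner c (v_alpha c g alpha s) (v_alpha c g alpha s) = 1.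
Proof.
unfold v_alpha, frame_t.
rewrite !inner_plus_l, !inner_plus_r, !inner_scal_l, !inner_scal_r,
  (inner_sym c (vderive g s) (frame_e c g s)), inner_tt, inner_e_e, inner_e_t.
generalize (sin2_cos2 alpha); unfold Rsqr; lra.
Qed.

Lemma curv_inner_v_g (s : R) : c * inner c (v_alpha c g alpha s) (g s) = 0.
Proof.
unfold v_alpha, frame_t; rewrite inner_plus_l, !inner_scal_l.
transitivity (cos alpha * (c * inner c (vderive g s) (g s))
  + sin alpha * (c * inner c (frame_e c g s) (g s))); [ring |].
rewrite curv_inner_t_g, curv_inner_e_g; ring.
Qed.

(** The cross term and the term in [<g, g>] carry factors [c] and [c ^ 2], so
    the facts scaled by [c] suffice and the flat case needs no exception. *)
Lemma geodesic_direction_unit (s : R) :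
  inner c (geodesic_direction s) (geodesic_direction s) = 1.
Proof.
unfold geodesic_direction.
set (C := cosc c (rho c k alpha s)); set (S := sinc c (rho c k alpha s)).
rewrite !inner_plus_l, !inner_plus_r, !inner_scal_l, !inner_scal_r,
  (inner_sym c (g s) (v_alpha c g alpha s)), inner_v_v.
transitivity (C * C + S * S * (c * (c * inner c (g s) (g s)))
  - 2 * C * S * (c * inner c (v_alpha c g alpha s) (g s))); [ring |].
rewrite curv_inner_g_g, curv_inner_v_g.
generalize (cosc2_sinc2 c (rho c k alpha s)); fold C S; lra.
Qed.

Lemma evolutoid_speed (s : R) :
  normc c (vderive (evolutoid c g k alpha) s) = Rabs (drho s + cos alpha).
Proof.
rewrite (has_velocity_vderive _ _ _ (evolutoid_velocity s)).
unfold normc; rewrite inner_scal_l, inner_scal_r, geodesic_direction_unit.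
rewrite Rmult_1_r; apply sqrt_Rsqr_abs.
Qed.

(** On one period the speed is [drho + cos alpha] without absolute value, and
    [drho] integrates to zero because [rho] has period [l]. *)
Lemma length_evolutoid :
  (forall s, 0 <= s <= l -> Rabs (drho s) < cos alpha) ->
  length c (evolutoid c g k alpha) l = cos alpha * l.
Proof.
intros B; unfold length.
assert (L := cc_length_pos _ _ _ _ Hg).
assert (I : is_RInt drho 0 l 0).
{ replace 0 with (minus (rho c k alpha l) (rho c k alpha 0)) at 2.
  - apply (is_RInt_derive (rho c k alpha));
      intros s _; [apply is_derive_rho | apply continuous_drho].
  - rewrite <- (Rplus_0_l l) at 1; rewrite rho_periodic.
    unfold minus, plus, opp; simpl; ring. }
assert (J := is_RInt_plus _ _ _ _ _ _ I (is_RInt_const 0 l (cos alpha))).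
apply is_RInt_unique.
replace (cos alpha * l) with (plus 0 (scal (l - 0) (cos alpha)))
  by (unfold plus, scal; simpl; unfold mult; simpl; ring).
eapply is_RInt_ext; [| exact J].
rewrite Rmin_left, Rmax_right by lra; intros s Hs; simpl.
rewrite evolutoid_speed, Rabs_pos_eq; [reflexivity |].
assert (H := B s ltac:(lra)); apply Rabs_def2 in H; lra.
Qed.

Lemma length_arc_length_parametrized : length c g l = l.
Proof.
unfold length.
rewrite (RInt_ext _ (fun _ => 1)) by (intros; apply (cc_arc_length _ _ _ _ Hg)).
rewrite RInt_const; unfold scal; simpl; unfold mult; simpl; ring.
Qed.

End Frenet.

Theorem proposition4p1 (c : curvature) (l : R) (g : R -> vec) (k : R -> R)
    (Hg : convex_closed_curve c l g k)
    (alpha_star : R) (Hstar : is_alpha_star c l k alpha_star)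
    (alpha : R) (Halpha : 0 <= alpha < alpha_star) :
  length c (evolutoid c g k alpha) l = cos alpha * length c g l.
Proof.
rewrite (length_arc_length_parametrized c l g k Hg).
apply (length_evolutoid c l g k Hg); intros s Hs.
destruct Hstar as [[_ B] _].
rewrite <- (is_derive_unique _ _ _ (is_derive_rho c l g k Hg alpha s)).
now apply B.
Qed.
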